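(* Let $I_1,I_2\subset\mathbf{R}$ be open intervals, let $\gamma=(\gamma_1,\gamma_2):I_1\to S^3$ be a unit speed Legendre curve in $S^3$ and $\alpha=(\alpha_1,\alpha_2):I_2\to H^3_1$ a unit speed Legendre curve in $H^3_1$, such that the map $$\phi:I_2\times I_1\to\mathbf{C}^2,\qquad \phi(t,s)=(\alpha_1(t)\gamma_1(s),\,\alpha_2(t)\gamma_2(s)),$$ is a (Lagrangian conformal) immersion. Then the mean curvature vector field of $\phi$ is given by $$H=\frac{e^{-2u}}{2}\left(k_\alpha J\phi_t+k_\gamma J\phi_s\right),$$ where $e^{2u}=|\gamma_1|^2+|\alpha_1|^2$ and $k_\alpha$ and $k_\gamma$ are the curvature functions of $\alpha$ and $\gamma$, respectively.
   Context: Curves are smooth. $S^3=\{(z,w)\in\mathbf{C}^2:|z|^2+|w|^2=1\}$. A unit speed Legendre curve $\gamma$ in $S^3$ satisfies $|\gamma_1|^2+|\gamma_2|^2=1$, $|\gamma_1'|^2+|\gamma_2'|^2=1$, $\gamma_1'\bar\gamma_1+\gamma_2'\bar\gamma_2=0$. $H^3_1=\{(z,w)\in\mathbf{C}^2:|z|^2-|w|^2=-1\}$. A unit speed Legendre curve $\alpha$ in $H^3_1$ satisfies $|\alpha_1|^2-|\alpha_2|^2=-1$, $|\alpha_1'|^2-|\alpha_2'|^2=1$, $\alpha_1'\bar\alpha_1-\alpha_2'\bar\alpha_2=0$. The curvature functions are the signed curvatures $k_\gamma=\mathrm{Re}\big(\gamma_1''\overline{i\gamma_1'}+\gamma_2''\overline{i\gamma_2'}\big)$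 and $k_\alpha=\mathrm{Re}\big(\alpha_1''\overline{i\alpha_1'}-\alpha_2''\overline{i\alpha_2'}\big)$; equivalently they are the real functions with $\gamma''-ik_\gamma\gamma'+\gamma=0$ and $\alpha''-ik_\alpha\alpha'-\alpha=0$. The metric induced by $\phi$ from the Euclidean metric is $(|\gamma_1|^2+|\alpha_1|^2)(dt^2+ds^2)$, so $\phi$ is an immersion exactly when $|\gamma_1(s)|^2+|\alpha_1(t)|^2\neq0$ everywhere. $J$ is multiplication by $i$ on $\mathbf{C}^2$, and $H=\frac12\mathrm{trace}\,\sigma$, where $\sigma$ is the second fundamental form of $\phi$. *)

(* Defs.v *)
From Stdlib Require Import Reals List.
From Coquelicot Require Import Coquelicot.
Open Scope R_scope.

Definition is_open_interval (I : R -> Prop) : Prop :=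
  exists a b : Rbar, Rbar_lt a b /\
    forall x : R, I x <-> Rbar_lt a x /\ Rbar_lt x b.

(** Scalars are complex; a real scalar [r] acts as [RtoC r]. *)

Definition C2 : Type := (C * C)%type.

Definition C2scal (c : C) (v : C2) : C2 := scal c v.

Definition J (v : C2) : C2 := C2scal Ci v.

(** The Euclidean inner product of R^4: the real part of the Hermitian one. *)
Definition dot (v w : C2) : R :=
  Re (fst v * Cconj (fst w) + snd v * Cconj (snd w))%C.

(** Curves are total functions; only their values on an open interval matter.
    Derivatives are taken in each of the four real components. *)

Definition Cderive (f : R -> C) (x : R) : C :=
  (Derive (fun y => Re (f y)) x, Derive (fun y => Im (f y)) x).

Definition deriv (c : R -> C2) (x : R) : C2 :=
  (Cderive (fun y => fst (c y)) x, Cderive (fun y => snd (c y)) x).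

Definition Csmooth_on (I : R -> Prop) (f : R -> C) : Prop :=
  forall (n : nat) (x : R), I x ->
    ex_derive_n (fun y => Re (f y)) n x /\ ex_derive_n (fun y => Im (f y)) n x.

Definition smooth_curve_on (I : R -> Prop) (c : R -> C2) : Prop :=
  Csmooth_on I (fun x => fst (c x)) /\ Csmooth_on I (fun x => snd (c x)).

Definition unit_speed_Legendre_S3 (I : R -> Prop) (c : R -> C2) : Prop :=
  smooth_curve_on I c /\
  forall s : R, I s ->
    Cmod (fst (c s)) ^ 2 + Cmod (snd (c s)) ^ 2 = 1 /\
    Cmod (fst (deriv c s)) ^ 2 + Cmod (snd (deriv c s)) ^ 2 = 1 /\
    (fst (deriv c s) * Cconj (fst (c s))
     + snd (deriv c s) * Cconj (snd (c s)))%C = RtoC 0.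

Definition unit_speed_Legendre_H31 (I : R -> Prop) (c : R -> C2) : Prop :=
  smooth_curve_on I c /\
  forall t : R, I t ->
    Cmod (fst (c t)) ^ 2 - Cmod (snd (c t)) ^ 2 = -1 /\
    Cmod (fst (deriv c t)) ^ 2 - Cmod (snd (deriv c t)) ^ 2 = 1 /\
    (fst (deriv c t) * Cconj (fst (c t))
     - snd (deriv c t) * Cconj (snd (c t)))%C = RtoC 0.

(** Signed curvature with respect to the normal i c'. *)
Definition curvature_S3 (c : R -> C2) (s : R) : R :=
  let c' := deriv c s in
  let c'' := deriv (deriv c) s in
  Re (fst c'' * Cconj (Ci * fst c') + snd c'' * Cconj (Ci * snd c'))%C.

Definition curvature_H31 (c : R -> C2) (t : R) : R :=
  let c' := deriv c t in
  let c'' := deriv (deriv c) t in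
  Re (fst c'' * Cconj (Ci * fst c') - snd c'' * Cconj (Ci * snd c'))%C.

Inductive coord : Set := coord_t | coord_s.

Definition Rpartial (i : coord) (f : R -> R -> R) (t s : R) : R :=
  match i with
  | coord_t => Derive (fun x => f x s) t
  | coord_s => Derive (fun y => f t y) s
  end.

Definition partial (i : coord) (phi : R -> R -> C2) (t s : R) : C2 :=
  match i with
  | coord_t => deriv (fun x => phi x s) t
  | coord_s => deriv (fun y => phi t y) s
  end.

Fixpoint iter_Rpartial (w : list coord) (f : R -> R -> R) : R -> R -> R :=
  match w with
  | nil => f
  | i :: w' => Rpartial i (iter_Rpartial w' f)
  end%list.

(** All iterated partial derivatives exist and are continuous on U. *)
Definition Rsmooth_on (U : R -> R -> Prop) (f : R -> R -> R) : Prop :=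
  forall (w : list coord) (t s : R), U t s ->
    continuity_2d_pt (iter_Rpartial w f) t s /\
    ex_derive (fun x => iter_Rpartial w f x s) t /\
    ex_derive (fun y => iter_Rpartial w f t y) s.

Definition smooth_surface_on (U : R -> R -> Prop) (phi : R -> R -> C2) : Prop :=
  Rsmooth_on U (fun t s => Re (fst (phi t s))) /\
  Rsmooth_on U (fun t s => Im (fst (phi t s))) /\
  Rsmooth_on U (fun t s => Re (snd (phi t s))) /\
  Rsmooth_on U (fun t s => Im (snd (phi t s))).

(** The differential at (t, s) is (x, y) |-> x phi_t + y phi_s. *)
Definition immersion_on (U : R -> R -> Prop) (phi : R -> R -> C2) : Prop :=
  smooth_surface_on U phi /\
  forall t s : R, U t s ->
    forall x y : R,
      plus (C2scal (RtoC x) (partial coord_t phi t s))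
           (C2scal (RtoC y) (partial coord_s phi t s)) = zero ->
      x = 0 /\ y = 0.

Section Immersed_surface.

Variable phi : R -> R -> C2.

Definition metric (i j : coord) (t s : R) : R :=
  dot (partial i phi t s) (partial j phi t s).

Definition metric_det (t s : R) : R :=
  metric coord_t coord_t t s * metric coord_s coord_s t s
  - metric coord_t coord_s t s * metric coord_s coord_t t s.

(** The inverse matrix (g^{ij}) of the metric (g_{ij}). *)
Definition inverse_metric (i j : coord) (t s : R) : R :=
  match i, j with
  | coord_t, coord_t => metric coord_s coord_s t s / metric_det t s
  | coord_s, coord_s => metric coord_t coord_t t s / metric_det t s
  | coord_t, coord_s => - metric coord_t coord_s t s / metric_det t s
  | coord_s, coord_t => - metric coord_s coord_t t s / metric_det t s
  end.

Definition sum_coord (F : coord -> coord -> C2) : C2 :=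
  plus (plus (F coord_t coord_t) (F coord_t coord_s))
       (plus (F coord_s coord_t) (F coord_s coord_s)).

(** Orthogonal projection onto the tangent plane span(phi_t, phi_s):
    sum_{i,j} g^{ij} <v, phi_i> phi_j. *)
Definition tangent_part (t s : R) (v : C2) : C2 :=
  sum_coord (fun i j =>
    C2scal (RtoC (inverse_metric i j t s * dot v (partial i phi t s)))
           (partial j phi t s)).

Definition normal_part (t s : R) (v : C2) : C2 :=
  plus v (opp (tangent_part t s v)).

(** sigma(d_i, d_j): by the Gauss formula, and because the ambient space is
    flat, this is the normal component of the second partial derivative. *)
Definition second_fundamental_form (i j : coord) (t s : R) : C2 :=
  normal_part t s (partial i (partial j phi) t s).

(** Half the trace of sigma with respect to the induced metric. *)
Definition mean_curvature_vector (t s : R) : C2 :=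
  C2scal (RtoC (1 / 2))
    (sum_coord (fun i j =>
       C2scal (RtoC (inverse_metric i j t s))
              (second_fundamental_form i j t s))).

End Immersed_surface.

Definition product_map (alpha gamma : R -> C2) (t s : R) : C2 :=
  (fst (alpha t) * fst (gamma s), snd (alpha t) * snd (gamma s))%C.

(* Main.v *)
Require Import Defs.
From Stdlib Require Import Reals Lra.
From Coquelicot Require Import Coquelicot.
Open Scope R_scope.

(** A curve in [C^2] whose position and velocity are orthonormal for the
    Hermitian form [|z|^2 + e |w|^2] has its acceleration determined by them:
    differentiating the Legendre and unit speed conditions yields the Frenet
    equation [c'' = k J c' - e c] ([Legendre_structure_equation]). The sphere is
    the case [e = 1] and the anti-de Sitter space the case [e = -1], so one
    proof serves both curves.

    For the product map [phi] this gives [phi_tt = k_alpha J phi_t + phi] and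
    [phi_ss = k_gamma J phi_s - phi], and the two copies of [phi] cancel in the
    Laplacian ([product_map_laplacian]).

    The Legendre conditions also make [phi_t] and [phi_s] orthogonal for the
    Hermitian form of [C^2], with the same squared norm
    [E = |gamma_1|^2 + |alpha_1|^2]. Hence the coordinates are conformal, so
    that [2 H] is the normal part of the Laplacian divided by [E]
    ([mean_curvature_conformal]), and [phi] is Lagrangian, so that [J phi_t] and
    [J phi_s] are already normal ([dot_J_lagrangian]). An immersion has
    [phi_t] nonzero, so [E > 0] and [u] can be half the logarithm of [E]. *)

(** * Algebra of C2 and the Hermitian forms of S^3 and H^3_1 *)

Lemma C2scalE (c : C) (v : C2) : C2scal c v = ((c * fst v)%C, (c * snd v)%C).
Proof. reflexivity. Qed.

Lemma C2plusE (v w : C2) :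
  plus v w = ((fst v + fst w)%C, (snd v + snd w)%C).
Proof. reflexivity. Qed.

Lemma C2oppE (v : C2) : opp v = ((- fst v)%C, (- snd v)%C).
Proof. reflexivity. Qed.

Lemma C2zeroE : zero = (RtoC 0, RtoC 0) :> C2.
Proof. reflexivity. Qed.

(** Linear identities between vectors, checked in each complex coordinate. The
    type of the equation is reset to [C], which projections of pairs present as
    [R * R], since the ring structure is attached to the name [C]. *)
Ltac C2ring :=
  unfold J; rewrite ?C2scalE, ?C2plusE, ?C2oppE, ?C2zeroE; simpl fst; simpl snd;
  apply injective_projections; simpl fst; simpl snd;
  rewrite ?RtoC_plus, ?RtoC_mult, ?RtoC_opp;
  match goal with |- ?a = ?b => change (@eq C a b) end; ring.

Definition herm (e : R) (v w : C2) : C :=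
  (fst v * Cconj (fst w) + RtoC e * (snd v * Cconj (snd w)))%C.

Lemma Cconj_RtoC (r : R) : Cconj (RtoC r) = RtoC r.
Proof. unfold Cconj, RtoC; simpl; now rewrite Ropp_0. Qed.

Lemma RtoC_m1 : RtoC (-1) = (- (1))%C.
Proof. exact (RtoC_opp 1). Qed.

Lemma Cconj_Ci : Cconj Ci = (- Ci)%C.
Proof. unfold Cconj, Ci, Copp; simpl; now rewrite Ropp_0. Qed.

Lemma herm_conj (e : R) (v w : C2) : Cconj (herm e v w) = herm e w v.
Proof.
  unfold herm.
  rewrite Cplus_conj, !Cmult_conj, !Cconj_conj, Cconj_RtoC; ring.
Qed.

Lemma herm_plus_l (e : R) (u v w : C2) :
  herm e (plus u v) w = (herm e u w + herm e v w)%C.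
Proof. rewrite C2plusE; unfold herm; simpl; ring. Qed.

Lemma herm_scal_l (e : R) (c : C) (v w : C2) :
  herm e (C2scal c v) w = (c * herm e v w)%C.
Proof. rewrite C2scalE; unfold herm; simpl; ring. Qed.

Lemma herm_scal_r (e : R) (c : C) (v w : C2) :
  herm e v (C2scal c w) = (Cconj c * herm e v w)%C.
Proof. rewrite C2scalE; unfold herm; simpl; rewrite !Cmult_conj; ring. Qed.

Lemma herm_diag (e : R) (v : C2) :
  herm e v v = RtoC (Cmod (fst v) ^ 2 + e * Cmod (snd v) ^ 2).
Proof.
  unfold herm; rewrite RtoC_plus, RtoC_mult, !Cmod2_conj; ring.
Qed.

Lemma dot_herm (v w : C2) : dot v w = Re (herm 1 v w).
Proof. unfold dot, herm; f_equal; ring. Qed.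

Lemma herm_definite (v : C2) : herm 1 v v = RtoC 0 -> v = zero.
Proof.
  rewrite herm_diag; intros h; apply RtoC_inj in h.
  rewrite C2zeroE; apply injective_projections; apply Cmod_eq_0; nra.
Qed.

(** By the Cauchy-Binet formula the determinant of an orthonormal pair [(c, p)]
    has modulus one, whence only zero is orthogonal to both vectors. *)
Lemma orthonormal_pair_nondegenerate (e : R) (c p w : C2) :
  e * e = 1 -> herm e c c = RtoC e -> herm e p p = RtoC 1 ->
  herm e p c = RtoC 0 ->
  herm e w c = RtoC 0 -> herm e w p = RtoC 0 -> w = zero.
Proof.
  intros he hcc hpp hpc hwc hwp.
  apply (f_equal RtoC) in he; rewrite RtoC_mult in he.
  assert (hcp : herm e c p = RtoC 0)
    by (rewrite <- herm_conj, hpc; apply Cconj_RtoC).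
  set (D := (fst c * snd p - snd c * fst p)%C).
  assert (hD : (Cconj D * D = 1)%C).
  { transitivity (RtoC e * RtoC e * (Cconj D * D))%C; [rewrite he; ring |].
    transitivity (RtoC e * (herm e c c * herm e p p
                            - herm e p c * herm e c p))%C.
    - unfold D, herm; rewrite Cminus_conj, !Cmult_conj; ring.
    - rewrite hcc, hpp, hpc.
      transitivity (RtoC e * RtoC e)%C; [ring | exact he]. }
  assert (h1 : (fst w * Cconj D = 0)%C).
  { transitivity (herm e w c * Cconj (snd p) - herm e w p * Cconj (snd c))%C.
    - unfold D, herm; rewrite Cminus_conj, !Cmult_conj; ring.
    - rewrite hwc, hwp; ring. }
  assert (h2 : (snd w * Cconj D = 0)%C).
  { transitivity (RtoC e * (herm e w p * Cconj (fst c)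
                            - herm e w c * Cconj (fst p)))%C.
    - unfold D, herm; rewrite Cminus_conj, !Cmult_conj.
      transitivity ((RtoC e * RtoC e) * (snd w *
        (Cconj (fst c) * Cconj (snd p) - Cconj (snd c) * Cconj (fst p))))%C.
      + rewrite he; ring.
      + ring.
    - rewrite hwc, hwp; ring. }
  rewrite C2zeroE; apply injective_projections; simpl.
  - transitivity (fst w * Cconj D * D)%C; [| rewrite h1; ring].
    rewrite <- Cmult_assoc, hD; ring.
  - transitivity (snd w * Cconj D * D)%C; [| rewrite h2; ring].
    rewrite <- Cmult_assoc, hD; ring.
Qed.

Lemma orthonormal_pair_expansion (e : R) (c p v : C2) :
  e * e = 1 -> herm e c c = RtoC e -> herm e p p = RtoC 1 ->
  herm e p c = RtoC 0 ->
  v = plus (C2scal (RtoC e * herm e v c)%C c) (C2scal (herm e v p) p).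
Proof.
  intros he hcc hpp hpc.
  assert (hcp : herm e c p = RtoC 0)
    by (rewrite <- herm_conj, hpc; apply Cconj_RtoC).
  set (x := (RtoC e * herm e v c)%C); set (y := herm e v p).
  assert (hw : plus v (plus (C2scal (- x)%C c) (C2scal (- y)%C p)) = zero).
  { apply (orthonormal_pair_nondegenerate e c p); trivial;
      rewrite !herm_plus_l, !herm_scal_l.
    - rewrite hcc, hpc; unfold x.
      apply (f_equal RtoC) in he; rewrite RtoC_mult in he.
      transitivity (herm e v c * (1 - RtoC e * RtoC e))%C; [ring |].
      rewrite he; ring.
    - rewrite hpp, hcp; fold y; ring. }
  transitivity (plus (plus v (plus (C2scal (- x)%C c) (C2scal (- y)%C p)))
                     (plus (C2scal x c) (C2scal y p))).
  - C2ring.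
  - rewrite hw; C2ring.
Qed.

(** A unitary matrix has orthonormal columns as well as orthonormal rows: the
    expansions of the two basis vectors of [C^2] give the norms of the columns
    of the pair, and [c] lies on the quadric. *)
Lemma orthonormal_pair_columns (e : R) (c p : C2) :
  e * e = 1 -> herm e c c = RtoC e -> herm e p p = RtoC 1 ->
  herm e p c = RtoC 0 ->
  (fst p * Cconj (fst p) = snd c * Cconj (snd c))%C /\
  (snd p * Cconj (snd p) = fst c * Cconj (fst c))%C.
Proof.
  intros he hcc hpp hpc.
  pose proof (fun v => orthonormal_pair_expansion e c p v he hcc hpp hpc) as hx.
  pose proof (f_equal fst (hx (RtoC 1, RtoC 0))) as h1.
  pose proof (f_equal snd (hx (RtoC 0, RtoC 1))) as h2.
  rewrite C2plusE, !C2scalE in h1, h2; unfold herm in h1, h2, hcc.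
  simpl in h1, h2.
  apply (f_equal RtoC) in he; rewrite RtoC_mult in he.
  assert (hc : (RtoC e * (fst c * Cconj (fst c)) + snd c * Cconj (snd c)
                = RtoC 1)%C).
  { rewrite <- he; rewrite <- hcc at 3.
    transitivity (RtoC e * (fst c * Cconj (fst c))
                  + RtoC e * RtoC e * (snd c * Cconj (snd c)))%C;
      [rewrite he |]; ring. }
  split.
  - transitivity (RtoC 1 - RtoC e * (fst c * Cconj (fst c)))%C;
      [rewrite h1 at 1 | rewrite <- hc]; ring.
  - transitivity (RtoC e * RtoC e * (snd p * Cconj (snd p)))%C;
      [rewrite he; ring |].
    transitivity (RtoC e * (RtoC 1 - RtoC e * RtoC e
                                     * (snd c * Cconj (snd c))))%C.
    + rewrite h2 at 1; ring.
    + rewrite he, <- hc at 1.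
      transitivity (RtoC e * RtoC e * (fst c * Cconj (fst c)))%C;
        [| rewrite he]; ring.
Qed.

(** * Derivatives of complex-valued functions *)

Definition is_Cderive (f : R -> C) (x : R) (l : C) : Prop :=
  is_derive (fun y => Re (f y)) x (Re l) /\
  is_derive (fun y => Im (f y)) x (Im l).

Definition is_C2derive (c : R -> C2) (x : R) (v : C2) : Prop :=
  is_Cderive (fun y => fst (c y)) x (fst v) /\
  is_Cderive (fun y => snd (c y)) x (snd v).

Lemma is_Cderive_unique (f : R -> C) (x : R) (l : C) :
  is_Cderive f x l -> Cderive f x = l.
Proof.
  intros [h1 h2]; unfold Cderive.
  apply injective_projections; now apply is_derive_unique.
Qed.

Lemma is_C2derive_unique (c : R -> C2) (x : R) (v : C2) :
  is_C2derive c x v -> deriv c x = v.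
Proof.
  intros [h1 h2]; unfold deriv.
  rewrite (is_Cderive_unique _ _ _ h1), (is_Cderive_unique _ _ _ h2).
  now destruct v.
Qed.

Lemma is_Cderive_const (a : C) (x : R) : is_Cderive (fun _ => a) x (RtoC 0).
Proof. split; exact (is_derive_const _ _). Qed.

Lemma is_Cderive_plus (f g : R -> C) (x : R) (lf lg : C) :
  is_Cderive f x lf -> is_Cderive g x lg ->
  is_Cderive (fun y => f y + g y)%C x (lf + lg)%C.
Proof.
  intros [f1 f2] [g1 g2]; split.
  - exact (is_derive_plus _ _ _ _ _ f1 g1).
  - exact (is_derive_plus _ _ _ _ _ f2 g2).
Qed.

Lemma is_Cderive_mult (f g : R -> C) (x : R) (lf lg : C) :
  is_Cderive f x lf -> is_Cderive g x lg ->
  is_Cderive (fun y => f y * g y)%C x (lf * g x + f x * lg)%C.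
Proof.
  intros [f1 f2] [g1 g2]; split.
  - assert (h := is_derive_minus _ _ _ _ _
      (Derive.is_derive_mult _ _ _ _ _ f1 g1)
      (Derive.is_derive_mult _ _ _ _ _ f2 g2)).
    replace (Re (lf * g x + f x * lg)%C) with
      (minus (Re lf * Re (g x) + Re (f x) * Re lg)
             (Im lf * Im (g x) + Im (f x) * Im lg)).
    + exact h.
    + unfold minus, plus, opp, Re, Im; simpl; ring.
  - assert (h := is_derive_plus _ _ _ _ _
      (Derive.is_derive_mult _ _ _ _ _ f1 g2)
      (Derive.is_derive_mult _ _ _ _ _ f2 g1)).
    replace (Im (lf * g x + f x * lg)%C) with
      (plus (Re lf * Im (g x) + Re (f x) * Im lg)
            (Im lf * Re (g x) + Im (f x) * Re lg)).
    + exact h.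
    + unfold plus, Re, Im; simpl; ring.
Qed.

Lemma is_Cderive_conj (f : R -> C) (x : R) (l : C) :
  is_Cderive f x l -> is_Cderive (fun y => Cconj (f y)) x (Cconj l).
Proof.
  intros [f1 f2]; split.
  - exact f1.
  - exact (is_derive_opp _ _ _ f2).
Qed.

Lemma is_Cderive_herm (e : R) (v w : R -> C2) (x : R) (dv dw : C2) :
  is_C2derive v x dv -> is_C2derive w x dw ->
  is_Cderive (fun y => herm e (v y) (w y)) x
    (herm e dv (w x) + herm e (v x) dw)%C.
Proof.
  intros [v1 v2] [w1 w2].
  assert (h := is_Cderive_plus _ _ _ _ _
    (is_Cderive_mult _ _ _ _ _ v1 (is_Cderive_conj _ _ _ w1))
    (is_Cderive_mult _ _ _ _ _ (is_Cderive_const (RtoC e) x)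
       (is_Cderive_mult _ _ _ _ _ v2 (is_Cderive_conj _ _ _ w2)))).
  cbv beta in h.
  match type of h with is_Cderive _ _ ?l =>
    replace (herm e dv (w x) + herm e (v x) dw)%C with l end.
  - exact h.
  - unfold herm; ring.
Qed.

Lemma Cderive_ext_loc (f g : R -> C) (x : R) :
  locally x (fun y => f y = g y) -> Cderive f x = Cderive g x.
Proof.
  intros h; unfold Cderive; f_equal; apply Derive_ext_loc;
    revert h; apply filter_imp; intros y hy; now rewrite hy.
Qed.

Lemma deriv_ext_loc (c d : R -> C2) (x : R) :
  locally x (fun y => c y = d y) -> deriv c x = deriv d x.
Proof.
  intros h; unfold deriv; f_equal; apply Cderive_ext_loc;
    revert h; apply filter_imp; intros y hy; now rewrite hy.
Qed.

Lemma is_Cderive_locally_const (f : R -> C) (x : R) (a l : C) :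
  locally x (fun y => f y = a) -> is_Cderive f x l -> l = RtoC 0.
Proof.
  intros h hl.
  rewrite <- (is_Cderive_unique _ _ _ hl), (Cderive_ext_loc _ _ _ h).
  apply is_Cderive_unique, is_Cderive_const.
Qed.

Lemma open_interval_locally (I : R -> Prop) (x : R) :
  is_open_interval I -> I x -> locally x I.
Proof.
  intros [a [b [_ hI]]] hx; apply hI in hx; destruct hx as [h1 h2].
  generalize (filter_and _ _ (open_Rbar_gt a x h1) (open_Rbar_lt b x h2)).
  apply filter_imp; intros y hy; now apply hI.
Qed.

Lemma smooth_is_C2derive (I : R -> Prop) (c : R -> C2) (x : R) :
  smooth_curve_on I c -> I x -> is_C2derive c x (deriv c x).
Proof.
  intros [h1 h2] hx.
  destruct (h1 1%nat x hx), (h2 1%nat x hx).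
  repeat split; now apply Derive_correct.
Qed.

Lemma smooth_is_C2derive2 (I : R -> Prop) (c : R -> C2) (x : R) :
  smooth_curve_on I c -> I x -> is_C2derive (deriv c) x (deriv (deriv c) x).
Proof.
  intros [h1 h2] hx.
  destruct (h1 2%nat x hx), (h2 2%nat x hx).
  repeat split; now apply Derive_correct.
Qed.

(** * Legendre curves *)

(** The sphere ([e = 1]) and the anti-de Sitter space ([e = -1]) are the
    quadrics [herm e z z = e]. *)
Definition unit_speed_Legendre (e : R) (I : R -> Prop) (c : R -> C2) : Prop :=
  smooth_curve_on I c /\
  forall x : R, I x ->
    herm e (c x) (c x) = RtoC e /\
    herm e (deriv c x) (deriv c x) = RtoC 1 /\
    herm e (deriv c x) (c x) = RtoC 0.

Definition Legendre_curvature (e : R) (c : R -> C2) (x : R) : R :=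
  Re (herm e (deriv (deriv c) x) (J (deriv c x))).

Lemma Legendre_S3 (I : R -> Prop) (c : R -> C2) :
  unit_speed_Legendre_S3 I c -> unit_speed_Legendre 1 I c.
Proof.
  intros [hs h]; split; trivial; intros x hx.
  destruct (h x hx) as [h1 [h2 h3]]; rewrite !herm_diag, !Rmult_1_l.
  repeat split; [now rewrite h1 | now rewrite h2 |].
  rewrite <- h3; unfold herm; ring.
Qed.

Lemma Legendre_H31 (I : R -> Prop) (c : R -> C2) :
  unit_speed_Legendre_H31 I c -> unit_speed_Legendre (-1) I c.
Proof.
  intros [hs h]; split; trivial; intros x hx.
  destruct (h x hx) as [h1 [h2 h3]]; rewrite !herm_diag.
  repeat split; [f_equal; lra | f_equal; lra |].
  rewrite <- h3; unfold herm; rewrite RtoC_m1; ring.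
Qed.

Lemma curvature_S3_Legendre (c : R -> C2) (x : R) :
  curvature_S3 c x = Legendre_curvature 1 c x.
Proof.
  unfold curvature_S3, Legendre_curvature, herm, J; rewrite C2scalE.
  f_equal; simpl; ring.
Qed.

Lemma curvature_H31_Legendre (c : R -> C2) (x : R) :
  curvature_H31 c x = Legendre_curvature (-1) c x.
Proof.
  unfold curvature_H31, Legendre_curvature, herm, J; rewrite C2scalE.
  f_equal; simpl; rewrite RtoC_m1; ring.
Qed.

(** Differentiating the Legendre condition gives
    [herm e c'' c = -1]; differentiating the unit speed condition shows that
    [herm e c'' c'] is purely imaginary. These products determine the
    coefficients of [c''] in the orthonormal pair [(c, c')]. *)
Lemma Legendre_structure_equation (e : R) (I : R -> Prop) (c : R -> C2)
  (x : R) :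
  e * e = 1 -> is_open_interval I -> unit_speed_Legendre e I c -> I x ->
  deriv (deriv c) x =
    plus (C2scal (RtoC (Legendre_curvature e c x)) (J (deriv c x)))
         (C2scal (RtoC (- e)) (c x)).
Proof.
  intros he hI [hs h] hx.
  assert (hloc := open_interval_locally I x hI hx).
  assert (d1 := smooth_is_C2derive I c x hs hx).
  assert (d2 := smooth_is_C2derive2 I c x hs hx).
  destruct (h x hx) as [hcc [hpp hpc]].
  set (p := deriv c x) in *; set (q := deriv (deriv c) x) in *.
  assert (hq1 : (herm e q (c x) + herm e p p = 0)%C).
  { apply (is_Cderive_locally_const
             (fun y => herm e (deriv c y) (c y)) x (RtoC 0)).
    - revert hloc; apply filter_imp; intros y hy; apply (h y hy).
    - exact (is_Cderive_herm e _ _ x _ _ d2 d1). }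
  assert (hq2 : (herm e q p + herm e p q = 0)%C).
  { apply (is_Cderive_locally_const
             (fun y => herm e (deriv c y) (deriv c y)) x (RtoC 1)).
    - revert hloc; apply filter_imp; intros y hy; apply (h y hy).
    - exact (is_Cderive_herm e _ _ x _ _ d2 d2). }
  rewrite hpp in hq1.
  assert (hqc : herm e q (c x) = RtoC (-1)).
  { transitivity ((herm e q (c x) + 1) - 1)%C; [ring |].
    rewrite hq1, RtoC_m1; ring. }
  assert (hqp : herm e q p = (Ci * RtoC (Legendre_curvature e c x))%C).
  { unfold Legendre_curvature; fold p q; unfold J.
    rewrite herm_scal_r, Cconj_Ci.
    rewrite <- (herm_conj e q p) in hq2.
    destruct (herm e q p) as [a b].
    injection hq2; intros _ ha; simpl in ha.
    apply injective_projections; simpl; lra. }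
  rewrite (orthonormal_pair_expansion e (c x) p q he hcc hpp hpc) at 1.
  rewrite hqc, hqp, RtoC_m1; C2ring.
Qed.

(** * The product map *)

Definition C2mul (v w : C2) : C2 := ((fst v * fst w)%C, (snd v * snd w)%C).

Lemma is_C2derive_C2mul_l (c : R -> C2) (x : R) (v w : C2) :
  is_C2derive c x v -> is_C2derive (fun y => C2mul (c y) w) x (C2mul v w).
Proof.
  intros [h1 h2]; split; simpl.
  - replace (fst v * fst w)%C with (fst v * fst w + fst (c x) * 0)%C by ring.
    exact (is_Cderive_mult _ _ _ _ _ h1 (is_Cderive_const (fst w) x)).
  - replace (snd v * snd w)%C with (snd v * snd w + snd (c x) * 0)%C by ring.
    exact (is_Cderive_mult _ _ _ _ _ h2 (is_Cderive_const (snd w) x)).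
Qed.

Lemma is_C2derive_C2mul_r (c : R -> C2) (x : R) (v w : C2) :
  is_C2derive c x v -> is_C2derive (fun y => C2mul w (c y)) x (C2mul w v).
Proof.
  intros [h1 h2]; split; simpl.
  - replace (fst w * fst v)%C with (0 * fst (c x) + fst w * fst v)%C by ring.
    exact (is_Cderive_mult _ _ _ _ _ (is_Cderive_const (fst w) x) h1).
  - replace (snd w * snd v)%C with (0 * snd (c x) + snd w * snd v)%C by ring.
    exact (is_Cderive_mult _ _ _ _ _ (is_Cderive_const (snd w) x) h2).
Qed.

Lemma partial_t_product_map (I : R -> Prop) (alpha gamma : R -> C2) (t s : R) :
  smooth_curve_on I alpha -> I t ->
  partial coord_t (product_map alpha gamma) t s
  = C2mul (deriv alpha t) (gamma s).
Proof.
  intros hs ht.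
  exact (is_C2derive_unique _ _ _
    (is_C2derive_C2mul_l alpha t _ (gamma s) (smooth_is_C2derive I _ _ hs ht))).
Qed.

Lemma partial_s_product_map (I : R -> Prop) (alpha gamma : R -> C2) (t s : R) :
  smooth_curve_on I gamma -> I s ->
  partial coord_s (product_map alpha gamma) t s
  = C2mul (alpha t) (deriv gamma s).
Proof.
  intros hs ht.
  exact (is_C2derive_unique _ _ _
    (is_C2derive_C2mul_r gamma s _ (alpha t) (smooth_is_C2derive I _ _ hs ht))).
Qed.

Lemma partial_tt_product_map (I : R -> Prop) (alpha gamma : R -> C2) (t s : R) :
  is_open_interval I -> smooth_curve_on I alpha -> I t ->
  partial coord_t (partial coord_t (product_map alpha gamma)) t s
  = C2mul (deriv (deriv alpha) t) (gamma s).
Proof.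
  intros hI hs ht.
  transitivity (deriv (fun x => C2mul (deriv alpha x) (gamma s)) t).
  - apply deriv_ext_loc.
    generalize (open_interval_locally I t hI ht); apply filter_imp.
    intros x hx; exact (partial_t_product_map I alpha gamma x s hs hx).
  - exact (is_C2derive_unique _ _ _
      (is_C2derive_C2mul_l _ t _ (gamma s) (smooth_is_C2derive2 I _ _ hs ht))).
Qed.

Lemma partial_ss_product_map (I : R -> Prop) (alpha gamma : R -> C2) (t s : R) :
  is_open_interval I -> smooth_curve_on I gamma -> I s ->
  partial coord_s (partial coord_s (product_map alpha gamma)) t s
  = C2mul (alpha t) (deriv (deriv gamma) s).
Proof.
  intros hI hs ht.
  transitivity (deriv (fun y => C2mul (alpha t) (deriv gamma y)) s).
  - apply deriv_ext_loc.
    generalize (open_interval_locally I s hI ht); apply filter_imp.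
    intros y hy; exact (partial_s_product_map I alpha gamma t y hs hy).
  - exact (is_C2derive_unique _ _ _
      (is_C2derive_C2mul_r _ s _ (alpha t) (smooth_is_C2derive2 I _ _ hs ht))).
Qed.

(** With [p = a1' conj a1] and [q = g1 conj g1'], the Legendre conditions say
    [a2' conj a2 = p] and [g2 conj g2' = - q], so the product is [p q - p q]. *)
Lemma herm_product_tangents (a a' g g' : C2) :
  herm (-1) a' a = RtoC 0 -> herm 1 g' g = RtoC 0 ->
  herm 1 (C2mul a' g) (C2mul a g') = RtoC 0.
Proof.
  intros ha hg.
  rewrite <- herm_conj, <- (Cconj_RtoC 0) in hg.
  apply (f_equal Cconj) in hg; rewrite !Cconj_conj in hg.
  transitivity (herm (-1) a' a * (fst g * Cconj (fst g'))
                + snd a' * Cconj (snd a) * herm 1 g g')%C.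
  - unfold herm, C2mul; simpl; rewrite !Cmult_conj, RtoC_m1; ring.
  - rewrite ha, hg; ring.
Qed.

Lemma quadric_cross_norm (a g : C2) :
  herm (-1) a a = RtoC (-1) -> herm 1 g g = RtoC 1 ->
  (snd a * Cconj (snd a) * (fst g * Cconj (fst g))
   + fst a * Cconj (fst a) * (snd g * Cconj (snd g)))%C
  = RtoC (Cmod (fst g) ^ 2 + Cmod (fst a) ^ 2).
Proof.
  rewrite !herm_diag, <- !Cmod2_conj, <- !RtoC_mult, <- RtoC_plus.
  intros ha%RtoC_inj hg%RtoC_inj; f_equal; nra.
Qed.

Lemma herm_product_tangent_t (a a' g : C2) :
  herm (-1) a a = RtoC (-1) -> herm (-1) a' a' = RtoC 1 ->
  herm (-1) a' a = RtoC 0 -> herm 1 g g = RtoC 1 ->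
  herm 1 (C2mul a' g) (C2mul a' g)
  = RtoC (Cmod (fst g) ^ 2 + Cmod (fst a) ^ 2).
Proof.
  intros haa ha'a' ha'a hgg; rewrite <- quadric_cross_norm by trivial.
  destruct (orthonormal_pair_columns (-1) a a') as [<- <-]; trivial; [lra |].
  unfold herm, C2mul; simpl; rewrite !Cmult_conj; ring.
Qed.

Lemma herm_product_tangent_s (a g g' : C2) :
  herm (-1) a a = RtoC (-1) -> herm 1 g g = RtoC 1 ->
  herm 1 g' g' = RtoC 1 -> herm 1 g' g = RtoC 0 ->
  herm 1 (C2mul a g') (C2mul a g')
  = RtoC (Cmod (fst g) ^ 2 + Cmod (fst a) ^ 2).
Proof.
  intros haa hgg hg'g' hg'g; rewrite <- quadric_cross_norm by trivial.
  destruct (orthonormal_pair_columns 1 g g') as [<- <-]; trivial; [lra |].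
  unfold herm, C2mul; simpl; rewrite !Cmult_conj; ring.
Qed.

(** The Frenet equations of the two curves contain [a] and [- g], whose
    contributions to the Laplacian of the product map are opposite. *)
Lemma product_map_laplacian (a a' a'' g g' g'' : C2) (k l : R) :
  a'' = plus (C2scal (RtoC k) (J a')) (C2scal (RtoC (- -1)) a) ->
  g'' = plus (C2scal (RtoC l) (J g')) (C2scal (RtoC (- 1)) g) ->
  plus (C2mul a'' g) (C2mul a g'')
  = plus (C2scal (RtoC k) (J (C2mul a' g))) (C2scal (RtoC l) (J (C2mul a g'))).
Proof.
  intros -> ->; unfold C2mul; rewrite !RtoC_opp, RtoC_m1; C2ring.
Qed.

(** * Conformal immersions *)

Lemma dot_sym (v w : C2) : dot v w = dot w v.
Proof. rewrite !dot_herm, <- herm_conj; apply re_conj. Qed.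

Lemma dot_plus_l (u v w : C2) : dot (plus u v) w = dot u w + dot v w.
Proof. rewrite !dot_herm, herm_plus_l; reflexivity. Qed.

Lemma normal_part_plus (phi : R -> R -> C2) (t s : R) (v w : C2) :
  normal_part phi t s (plus v w)
  = plus (normal_part phi t s v) (normal_part phi t s w).
Proof.
  unfold normal_part, tangent_part, sum_coord.
  rewrite !dot_plus_l, !Rmult_plus_distr_l; C2ring.
Qed.

Lemma normal_part_orthogonal (phi : R -> R -> C2) (t s : R) (v : C2) :
  dot v (partial coord_t phi t s) = 0 -> dot v (partial coord_s phi t s) = 0 ->
  normal_part phi t s v = v.
Proof.
  intros ht hs; unfold normal_part, tangent_part, sum_coord.
  rewrite ht, hs, !Rmult_0_r; C2ring.
Qed.

(** In conformal coordinates the trace with respect to the metric is the sum of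
    the pure second derivatives divided by the conformal factor, so the mixed
    derivatives do not enter. *)
Lemma mean_curvature_conformal (phi : R -> R -> C2) (t s E : R) :
  E <> 0 ->
  metric phi coord_t coord_t t s = E -> metric phi coord_s coord_s t s = E ->
  metric phi coord_t coord_s t s = 0 ->
  mean_curvature_vector phi t s
  = C2scal (RtoC (/ E / 2))
      (normal_part phi t s
         (plus (partial coord_t (partial coord_t phi) t s)
               (partial coord_s (partial coord_s phi) t s))).
Proof.
  intros hE htt hss hts.
  assert (hst : metric phi coord_s coord_t t s = 0)
    by (rewrite <- hts; apply dot_sym).
  rewrite normal_part_plus.
  unfold mean_curvature_vector, sum_coord, inverse_metric, metric_det.
  rewrite htt, hss, hts, hst.
  fold (second_fundamental_form phi coord_t coord_t t s).
  fold (second_fundamental_form phi coord_s coord_s t s).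
  replace (E / (E * E - 0 * 0)) with (/ E) by (field; trivial).
  replace (- 0 / (E * E - 0 * 0)) with 0 by (field; trivial).
  replace (/ E / 2) with (1 / 2 * / E) by (field; trivial).
  C2ring.
Qed.

(** The tangent plane of a Lagrangian surface is totally real, so [J] maps it to
    the normal plane. *)
Lemma dot_J_lagrangian (k l : R) (v w z : C2) :
  Im (herm 1 v z) = 0 -> Im (herm 1 w z) = 0 ->
  dot (plus (C2scal (RtoC k) (J v)) (C2scal (RtoC l) (J w))) z = 0.
Proof.
  intros hv hw; unfold J.
  rewrite dot_herm, herm_plus_l, !herm_scal_l.
  destruct (herm 1 v z) as [a b], (herm 1 w z) as [c d]; simpl in *.
  rewrite hv, hw; ring.
Qed.

(** * The mean curvature vector *)

Theorem corollary3p5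
  (I1 I2 : R -> Prop) (gamma alpha : R -> C2)
  (hI1 : is_open_interval I1) (hI2 : is_open_interval I2)
  (hgamma : unit_speed_Legendre_S3 I1 gamma)
  (halpha : unit_speed_Legendre_H31 I2 alpha)
  (himm : immersion_on (fun t s => I2 t /\ I1 s) (product_map alpha gamma)) :
  exists u : R -> R -> R,
    forall t s : R, I2 t -> I1 s ->
      exp (2 * u t s) = Cmod (fst (gamma s)) ^ 2 + Cmod (fst (alpha t)) ^ 2 /\
      mean_curvature_vector (product_map alpha gamma) t s =
        C2scal (RtoC (exp (- 2 * u t s) / 2))
          (plus
             (C2scal (RtoC (curvature_H31 alpha t))
                (J (partial coord_t (product_map alpha gamma) t s)))
             (C2scal (RtoC (curvature_S3 gamma s))
                (J (partial coord_s (product_map alpha gamma) t s)))).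
Proof.
  apply Legendre_S3 in hgamma; apply Legendre_H31 in halpha.
  destruct himm as [_ himm].
  set (E := fun t s => Cmod (fst (gamma s)) ^ 2 + Cmod (fst (alpha t)) ^ 2).
  exists (fun t s => ln (E t s) / 2); intros t s ht hs.
  assert (hka := Legendre_structure_equation (-1) I2 alpha t
                   ltac:(lra) hI2 halpha ht).
  assert (hkg := Legendre_structure_equation 1 I1 gamma s
                   ltac:(lra) hI1 hgamma hs).
  destruct halpha as [sa la], hgamma as [sg lg].
  destruct (la t ht) as [haa [hapap hapa]], (lg s hs) as [hgg [hgpgp hgpg]].
  assert (pt := partial_t_product_map I2 alpha gamma t s sa ht).
  assert (ps := partial_s_product_map I1 alpha gamma t s sg hs).
  assert (htt := herm_product_tangent_t _ _ _ haa hapap hapa hgg).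
  assert (hss := herm_product_tangent_s _ _ _ haa hgg hgpgp hgpg).
  assert (hts := herm_product_tangents _ _ _ _ hapa hgpg).
  assert (hst := f_equal Cconj hts); rewrite herm_conj, Cconj_RtoC in hst.
  fold (E t s) in htt, hss.
  assert (hE0 : E t s <> 0).
  { intros h0.
    rewrite h0 in htt; apply herm_definite in htt.
    destruct (himm t s (conj ht hs) 1 0) as [h1 _].
    - rewrite pt, htt; C2ring.
    - lra. }
  assert (hE : 0 < E t s).
  { unfold E in *; nra. }
  split.
  - replace (2 * (ln (E t s) / 2)) with (ln (E t s)) by field.
    now apply exp_ln.
  - replace (-2 * (ln (E t s) / 2)) with (- ln (E t s)) by field.
    rewrite exp_Ropp, exp_ln by exact hE.
    rewrite (mean_curvature_conformal _ t s (E t s) hE0).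
    + rewrite (partial_tt_product_map I2 alpha gamma t s hI2 sa ht).
      rewrite (partial_ss_product_map I1 alpha gamma t s hI1 sg hs).
      rewrite (product_map_laplacian _ _ _ _ _ _ _ _ hka hkg).
      rewrite curvature_H31_Legendre, curvature_S3_Legendre, pt, ps.
      rewrite normal_part_orthogonal; trivial; rewrite ?pt, ?ps;
        apply dot_J_lagrangian; rewrite ?htt, ?hss, ?hts, ?hst; reflexivity.
    + unfold metric; rewrite pt, dot_herm, htt; reflexivity.
    + unfold metric; rewrite ps, dot_herm, hss; reflexivity.
    + unfold metric; rewrite pt, ps, dot_herm, hts; reflexivity.
Qed.
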